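(* Let $I\subset S=K[x_1,\ldots,x_n]$ be an ideal of Borel type. Then there exist an integer $1\leq q\leq n$, some nonnegative integers $r_0,r_1,\ldots,r_{n-q}$, and some monomials $v_{0j}\in K[x_{1},\ldots,x_{q}]$ for $j\in \{1,\ldots,r_0\}$ and $v_{ij}\in K[x_{1},\ldots,x_{q+i-1}]$ for any $1\leq i\leq n-q$ and $j\in \{1,\ldots,r_i\}$, such that the set of minimal monomial generators $G(I)$ of $I$ is \[ \{ x_1^{a_1},\ldots,x_q^{a_q},v_{01},\ldots,v_{0r_0},v_{11}x_{q+1}^{a_{11}},\ldots, v_{1r_1}x_{q+1}^{a_{1r_1}},\ldots, v_{n-q,1}x_{n}^{a_{n-q,1}},\ldots, v_{n-q,r_{n-q}}x_n^{a_{n-q,r_{n-q}}} \}, \] where $a_j$ for $1\le j\le q$ and $a_{ij}$ for $1\le i\le n-q$, $1\le j\le r_i$ are some positive integers. Moreover, if $r_i>0$ for some $i\geq 1$, it follows that $r_{i+1}>0$. Also, for any $2\leq i\leq n-q$ and $1\leq j\leq r_i$ there exists some $1\leq k\leq r_{i-1}$ such that $v_{i-1,k}\mid v_{ij}$. Conversely, any monomial ideal $I\subset S$ with $G(I)$ satisfying the conditions above is an ideal of Borel type.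
   Context: $K$ is an infinite field, $n\geq 2$, and $S=K[x_1,\ldots,x_n]$ is the polynomial ring over $K$. A monomial ideal $I\subset S$ is of Borel type if $(I:x_j^\infty)=(I:(x_1,\ldots,x_j)^\infty)$ for all $j=1,\ldots,n$, where $(I:L^\infty)=\bigcup_{k\ge 1}(I:L^k)$ for an ideal $L$ and $(I:x_j^\infty)=(I:(x_j)^\infty)$. $G(I)$ denotes the minimal set of monomial generators of $I$. If $r_i=0$, there are no monomials $v_{ij}$ with that index $i$.
   Formalization: The clause ''if r_i>0 then r_{i+1}>0'' is false, e.g. for (x_1^2, x_1x_2) in K[x_1,x_2,x_3], and is replaced by ''if r_{i+1}>0 then r_i>0'' for 1≤i<n-q; the direct implication assumes I nonzero and proper, since G(0) and G(S) do not have the listed form. *)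

(* Defs.v *)
From HB Require Import structures.
From mathcomp Require Import all_boot all_order all_algebra.
From mathcomp.multinomials Require Import mpoly.

Set Implicit Arguments.
Unset Strict Implicit.
Unset Printing Implicit Defensive.

Import GRing.Theory.
Local Open Scope ring_scope.

Definition infinite_type (T : eqType) : Prop :=
  forall s : seq T, exists x : T, x \notin s.

Section Ideals.

Variables (n : nat) (K : fieldType).

Notation S := {mpoly K[n]}.

(* Ideals are Prop-valued subsets of S, compared extensionally by same_set. *)
Definition same_set (T : Type) (A B : T -> Prop) : Prop :=
  forall x, A x <-> B x.

Definition is_ideal (I : S -> Prop) : Prop :=
  [/\ I 0,
      forall f g, I f -> I g -> I (f + g)
    & forall h f, I f -> I (h * f)].

Definition ideal_gen (A : S -> Prop) : S -> Prop :=
  fun f => forall J : S -> Prop,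
    is_ideal J -> (forall g, A g -> J g) -> J f.

Definition ideal_mul (L M : S -> Prop) : S -> Prop :=
  ideal_gen (fun f => exists g h, [/\ L g, M h & f = g * h]).

Fixpoint ideal_pow (L : S -> Prop) (k : nat) : S -> Prop :=
  if k is k'.+1 then ideal_mul L (ideal_pow L k') else fun=> True.

Definition colon (I L : S -> Prop) : S -> Prop :=
  fun f => forall g, L g -> I (f * g).

Definition saturation (I L : S -> Prop) : S -> Prop :=
  fun f => exists k, (1 <= k)%N /\ colon I (ideal_pow L k) f.

Definition var_ideal (j : 'I_n) : S -> Prop :=
  ideal_gen (fun f => f = 'X_j).

Definition initial_vars_ideal (j : 'I_n) : S -> Prop :=
  ideal_gen (fun f => exists2 l : 'I_n, (l <= j)%N & f = 'X_l).

(* Monomials are identified with their exponent vectors in 'X_{1..n}. *)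
Definition monomials_ideal (A : 'X_{1..n} -> Prop) : S -> Prop :=
  ideal_gen (fun f => exists2 m, A m & f = 'X_[m]).

Definition monomial_ideal (I : S -> Prop) : Prop :=
  exists A : 'X_{1..n} -> Prop, same_set I (monomials_ideal A).

Definition borel_type (I : S -> Prop) : Prop :=
  monomial_ideal I /\
  forall j : 'I_n,
    same_set (saturation I (var_ideal j))
             (saturation I (initial_vars_ideal j)).

(* G = G(I): G generates I and no proper subset of G does. *)
Definition min_monomial_gens (I : S -> Prop) (G : 'X_{1..n} -> Prop) : Prop :=
  same_set I (monomials_ideal G) /\
  forall H : 'X_{1..n} -> Prop,
    (forall m, H m -> G m) -> same_set I (monomials_ideal H) -> same_set H G.

End Ideals.

Section Shape.

Variable n : nat.

(* x_t ^ e with variables numbered from 1 to n: the variable x_t corresponds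
   to the ordinal of value t - 1. *)
Definition xpow (t e : nat) : 'X_{1..n} :=
  [multinom if l.+1 == t then e else 0%N | l < n].

(* m is a monomial of K[x_1, ..., x_t]. *)
Definition in_first_vars (t : nat) (m : 'X_{1..n}) : Prop :=
  forall l : 'I_n, (t < l.+1)%N -> m l = 0%N.

(* a j, r i, v i j and b i j stand for a_j, r_i, v_ij and a_ij; their values
   outside the index ranges below are irrelevant. *)
Definition listed_gens (q : nat) (r : nat -> nat) (v : nat -> nat -> 'X_{1..n})
    (a : nat -> nat) (b : nat -> nat -> nat) : 'X_{1..n} -> Prop :=
  fun m =>
    [\/ exists j, (1 <= j <= q)%N /\ m = xpow j (a j),
        exists j, (1 <= j <= r 0%N)%N /\ m = v 0%N j
      | exists i j, [/\ (1 <= i <= n - q)%N, (1 <= j <= r i)%N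
                      & m = (v i j + xpow (q + i) (b i j))%MM]].

Record listing_conditions (q : nat) (r : nat -> nat)
    (v : nat -> nat -> 'X_{1..n})
    (a : nat -> nat) (b : nat -> nat -> nat) : Prop := ListingConditions {
  lc_q : (1 <= q <= n)%N;
  lc_v0 : forall j, (1 <= j <= r 0%N)%N -> in_first_vars q (v 0%N j);
  lc_v : forall i j, (1 <= i <= n - q)%N -> (1 <= j <= r i)%N ->
           in_first_vars (q + i - 1) (v i j);
  lc_a : forall j, (1 <= j <= q)%N -> (0 < a j)%N;
  lc_b : forall i j, (1 <= i <= n - q)%N -> (1 <= j <= r i)%N -> (0 < b i j)%N;
  (* The opposite implication fails: (x_1^2, x_1 x_2) in K[x_1, x_2, x_3] is of
     Borel type with q = 1, r_1 = 1 and r_2 = 0. *)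
  lc_r : forall i, (1 <= i)%N -> (i.+1 <= n - q)%N ->
           (0 < r i.+1)%N -> (0 < r i)%N;
  lc_dvd : forall i j, (2 <= i <= n - q)%N -> (1 <= j <= r i)%N ->
             exists k, (1 <= k <= r i.-1)%N /\ (v i.-1 k <= v i j)%MM
}.

End Shape.

(* Main.v *)
(* A monomial ideal is of Borel type exactly when, for l <= j, a monomial m
   with m x_j^k in I for some k also has m x_l^N in I for some N.  Given this
   exchange property, let q be the largest index such that I contains a pure
   power of x_q and sort G(I), finite by Dickson's lemma, by the last variable
   of each generator.  Trading the last variable of v x_(t+1)^b for x_t gives
   v x_t^N in I, and a generator dividing it must involve x_t by minimality:
   this is the divisibility v' | v.  Conversely, if a listed generator
   v_ij x_(q+i)^a divides m x_t^k and involves x_t, then, descending the chain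
   of divisibilities from v_ij, one finds for each variable x_l with
   q < l <= t a generator v' x_l^b such that v' divides m. *)
Require Import Defs.
From HB Require Import structures.
From mathcomp Require Import all_boot all_order all_algebra.
From mathcomp.multinomials Require Import mpoly.
From mathcomp Require Import zify.
From Stdlib Require Import Classical.

Set Implicit Arguments.
Unset Strict Implicit.
Unset Printing Implicit Defensive.

Import GRing.Theory.
Local Open Scope ring_scope.

(** * Monomial ideals through the supports of their elements *)

Definition dvd_some n (A : 'X_{1..n} -> Prop) (m : 'X_{1..n}) : Prop :=
  exists2 a, A a & (a <= m)%MM.

Lemma dvd_some_le n (A : 'X_{1..n} -> Prop) m1 m2 :
  (m1 <= m2)%MM -> dvd_some A m1 -> dvd_some A m2.
Proof. by move=> le12 [a Aa le_a]; exists a => //; apply: lepm_trans le12. Qed.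

Lemma seq_uniform_bound (T : eqType) (Q : T -> nat -> Prop) (s : seq T) :
  (forall x k1 k2, (k1 <= k2)%N -> Q x k1 -> Q x k2) ->
  (forall x, x \in s -> exists k, Q x k) ->
  exists N, forall x, x \in s -> Q x N.
Proof.
move=> Qle; elim: s => [|x s IHs] Qs; first by exists 0%N.
have [k Qk] := Qs x (mem_head x s).
have [y ys|N QN] := IHs; first by apply: Qs; rewrite inE ys orbT.
exists (maxn k N) => y; rewrite inE => /predU1P[->|ys].
  by apply: Qle Qk; rewrite leq_maxl.
by apply: Qle (QN y ys); rewrite leq_maxr.
Qed.

Lemma ideal_gen_ideal n (K : fieldType) (A : {mpoly K[n]} -> Prop) :
  is_ideal (ideal_gen A).
Proof.
split=> [J [] //|f g If Ig J HJ AJ|h f If J HJ AJ]; case: (HJ) => _ JD JM.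
  by apply: JD; [apply: If | apply: Ig].
by apply: JM; apply: If.
Qed.

Lemma mem_ideal_gen n (K : fieldType) (A : {mpoly K[n]} -> Prop) f :
  A f -> ideal_gen A f.
Proof. by move=> Af J _; apply. Qed.

(** An element of [ideal_gen] lies in every ideal containing the generators; these ideals, cut out
    by a condition on supports, are the ones it is tested against below. *)
Lemma msupp_ideal n (K : fieldType) (D : 'X_{1..n} -> Prop) :
  (forall m1 m2, (m1 <= m2)%MM -> D m1 -> D m2) ->
  is_ideal (fun f : {mpoly K[n]} => forall m, m \in msupp f -> D m).
Proof.
move=> Dle; split=> [m|f g Df Dg m|h f Df m]; first by rewrite msupp0.
  by move/msuppD_le; rewrite mem_cat => /orP[/Df|/Dg].
move/msuppM_le => /allpairsP[[m1 m2] /= [_ m2f ->]].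
exact: Dle (lem_addl m1 m2) (Df _ m2f).
Qed.

Lemma monomials_idealP n (K : fieldType) (A : 'X_{1..n} -> Prop)
    (f : {mpoly K[n]}) :
  monomials_ideal A f <-> (forall m, m \in msupp f -> dvd_some A m).
Proof.
split=> [If|Df].
  apply: (If (fun f => forall m, m \in msupp f -> dvd_some A m)).
    by apply: msupp_ideal => m1 m2; apply: dvd_some_le.
  move=> _ [m Am ->] m' /mem_msuppXP <-; exists m => //; exact: lepm_refl.
have [I0 ID IM] := ideal_gen_ideal
  (fun f : {mpoly K[n]} => exists2 m, A m & f = 'X_[m]).
rewrite [f]mpolyE; move: Df; elim: (msupp f) => [|m s IHs] Ds.
  by rewrite big_nil.
rewrite big_cons; apply: ID; last first.
  by apply: IHs => m' m's; apply: Ds; rewrite inE m's orbT.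
have [a Aa le_am] := Ds m (mem_head m s).
rewrite -mul_mpolyC -(submK le_am) mpolyXD mulrA; apply: IM.
by apply: mem_ideal_gen; exists a.
Qed.

Lemma monomials_idealX n (K : fieldType) (A : 'X_{1..n} -> Prop) m :
  monomials_ideal A ('X_[m] : {mpoly K[n]}) <-> dvd_some A m.
Proof.
rewrite monomials_idealP; split=> [|Am m' /mem_msuppXP <-] //.
by apply; apply/mem_msuppXP.
Qed.

(** * Saturations by variables and the exchange property *)

Lemma ideal_pow_expr n (K : fieldType) (L : {mpoly K[n]} -> Prop) f k :
  L f -> ideal_pow L k (f ^+ k).
Proof.
move=> Lf; elim: k => //= k IHk; apply: mem_ideal_gen.
by exists f, (f ^+ k); rewrite exprS.
Qed.

Lemma ideal_pow_degree n (K : fieldType) (L : {mpoly K[n]} -> Prop)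
    (d : 'X_{1..n} -> nat) :
  (forall m1 m2, d (m1 + m2)%MM = d m1 + d m2)%N ->
  (forall f, L f -> forall m, m \in msupp f -> (1 <= d m)%N) ->
  forall k f, ideal_pow L k f -> forall m, m \in msupp f -> (k <= d m)%N.
Proof.
move=> dD dL; elim=> //= k IHk f Lf.
apply: (Lf (fun f => forall m, m \in msupp f -> (k < d m)%N)).
  by apply: msupp_ideal => m1 m2 /submK <-; rewrite dD; lia.
move=> _ [g [h [Lg Lh ->]]] m /msuppM_le /allpairsP[[m1 m2] /= [m1g m2h ->]].
by rewrite dD -add1n leq_add //; [apply: dL m1g | apply: IHk m2h].
Qed.

(** Left to right, the colon condition is tested on the powers of a single variable. Right to left,
    finitely many pairs (monomial of [f], variable) allow a common exponent [N], and a high enough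
    power of the ideal forces some variable to occur at least [N] times. *)
Lemma saturation_varsP n (K : fieldType) (A : 'X_{1..n} -> Prop)
    (P : pred 'I_n) (B : {mpoly K[n]} -> Prop) f :
  (forall g, B g <-> exists2 l, P l & g = 'X_l) ->
  saturation (monomials_ideal A) (ideal_gen B) f <->
  (forall m l, m \in msupp f -> P l ->
     exists k, dvd_some A (m + U_(l) *+ k)%MM).
Proof.
move=> BP; split=> [[k [_ Ik]] m l mf Pl | Af].
  have /Ik : ideal_pow (ideal_gen B) k ('X_l ^+ k).
    by apply: ideal_pow_expr; apply: mem_ideal_gen; apply/BP; exists l.
  rewrite mpolyXn => /monomials_idealP Af; exists k; apply: Af.
  by rewrite (perm_mem (msuppMX _ _)) addmC map_f.
pose Q (x : 'X_{1..n} * 'I_n) k := dvd_some A (x.1 + U_(x.2) *+ k)%MM.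
have [||N QN] := @seq_uniform_bound _ Q
    [seq (m, l) | m <- msupp f, l <- [seq l <- enum 'I_n | P l]].
- move=> [m l] k1 k2 le12; apply: dvd_some_le; apply/mnm_lepP => i /=.
  by rewrite !mnmDE !mulmnE leq_add2l leq_mul2l le12 orbT.
- move=> _ /allpairsP[[m l] /= [mf + ->]].
  by rewrite mem_filter => /andP[Pl _]; apply: Af.
pose d (m : 'X_{1..n}) := (\sum_(l | P l) m l)%N.
(* Pigeonhole: a monomial of degree above [n * N] in at most [n] variables has some exponent at
   least [N]. *)
exists (n * N).+1; split=> // g Lg.
apply/monomials_idealP => _ /msuppM_le /allpairsP[[m1 m2] /= [m1f m2g ->]].
have d_gt: (n * N < d m2)%N.
  apply: ideal_pow_degree Lg _ m2g => [u w|h Lh].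
    by rewrite /d -big_split; apply: eq_bigr => l _; rewrite mnmDE.
  apply: (Lh (fun h => forall m, m \in msupp h -> (1 <= d m)%N)).
    apply: msupp_ideal => u w /mnm_lepP le_uw du; apply: leq_trans du _.
    by apply: leq_sum => l _; apply: le_uw.
  move=> _ /BP[l Pl ->] m /mem_msuppXP <-.
  by rewrite /d (bigD1 l) //= mnm1E eqxx.
have [l Pl leN]: exists2 l, P l & (N <= m2 l)%N.
  apply/exists_inP; apply: contraLR d_gt => /exists_inPn ltN.
  rewrite -leqNgt -[n in leqRHS]card_ord -sum_nat_const.
  rewrite [leqRHS](bigID P) /= -[leqLHS]addn0 leq_add //.
  by apply: leq_sum => l /ltN; rewrite -ltnNge => /ltnW.
apply: dvd_some_le (QN (m1, l) _) => /=; last first.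
  by rewrite allpairs_f // mem_filter Pl mem_enum.
apply/mnm_lepP => i; rewrite !mnmDE mulmnE mnm1E leq_add2l.
by case: eqP => [<-|_] //; rewrite mul1n.
Qed.

Lemma saturation_ext n (K : fieldType) (I J L : {mpoly K[n]} -> Prop) :
  same_set I J -> same_set (saturation I L) (saturation J L).
Proof.
by move=> IJ f; split=> -[k [k1 H]]; exists k; split=> // g Lg;
  apply/IJ; apply: H.
Qed.

(** Both saturations are conditions on the monomials of the support, so it is enough to compare them
    on a single ['X_[m]]. Only the inclusion of the saturation by [x_j] in the other one has
    content, and it is the exchange property. *)
Lemma borel_typeP n (K : fieldType) (A : 'X_{1..n} -> Prop)
    (I : {mpoly K[n]} -> Prop) :
  same_set I (monomials_ideal A) ->
  borel_type I <->
  (forall (j l : 'I_n) m k, (l <= j)%N -> dvd_some A (m + U_(j) *+ k)%MM ->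
     exists N, dvd_some A (m + U_(l) *+ N)%MM).
Proof.
move=> IA; have varP j : forall g : {mpoly K[n]},
    g = 'X_j <-> exists2 l, pred1 j l & g = 'X_l.
  by move=> g; split=> [->|[l /eqP -> ->]] //; exists j => /=.
have initP (j : 'I_n) : forall g : {mpoly K[n]},
    (exists2 l : 'I_n, (l <= j)%N & g = 'X_l) <->
    exists2 l, [pred l : 'I_n | (l <= j)%N] l & g = 'X_l by [].
split=> [[_ BI] j l m k le_lj Am | E].
  have /BI/(saturation_ext _ IA)/(saturation_varsP A _ (initP j)) :
      saturation I (var_ideal j) 'X_[m].
    apply/(saturation_ext _ IA)/(saturation_varsP A _ (varP j)).
    by move=> _ _ /mem_msuppXP <- /eqP ->; exists k.
  by apply=> //; apply/mem_msuppXP.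
split=> [|j f]; first by exists A.
split=> /(saturation_ext _ IA) H; apply/(saturation_ext _ IA).
  apply/(saturation_varsP A _ (initP j)) => m l mf le_lj.
  have [k] := (saturation_varsP A _ (varP j)).1 H m j mf (eqxx j).
  exact: E.
apply/(saturation_varsP A _ (varP j)) => m _ mf /eqP ->.
exact: (saturation_varsP A _ (initP j)).1 H m j mf (leqnn j).
Qed.

(** * Dickson's lemma and minimal generators *)

Lemma dickson n (P : 'X_{1..n} -> Prop) :
  exists s : seq 'X_{1..n}, (forall g, g \in s -> P g) /\
    forall m, P m -> exists2 g, g \in s & (g <= m)%MM.
Proof.
(* Comparing only the first [k] exponents makes an induction on [k] possible without changing the
   number of variables. *)
suff dom k : exists s : seq 'X_{1..n}, (forall g, g \in s -> P g) /\
    forall m, P m ->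
      exists2 g, g \in s & forall i : 'I_n, (i < k)%N -> (g i <= m i)%N.
  have [s [sP Ps]] := dom n; exists s; split=> // m /Ps[g gs le_gm].
  by exists g => //; apply/mnm_lepP => i; apply: le_gm.
elim: k P => [|k IHk] P.
  case: (classic (exists m, P m)) => [[m Pm]|noP].
    by exists [:: m]; split=> [g /[!inE] /eqP -> //|m' _]; exists m; rewrite ?inE.
  by exists nil; split=> // m Pm; case: noP; exists m.
have [s [sP Ps]] := IHk P.
have [lt_kn|le_nk] := ltnP k n; last first.
  exists s; split=> // m /Ps[g gs le_gm]; exists g => // i _.
  exact: le_gm (leq_trans (ltn_ord i) le_nk).
pose o := Ordinal lt_kn.
have lt_ordS (i : 'I_n) : (i < k.+1)%N -> i = o \/ (i < k)%N.
  by rewrite ltnS leq_eqVlt => /orP[/eqP io|]; [left; apply: val_inj | right].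
(* Elements of [P] with a large [k]-th exponent lie above some element of [s];
   the others fall into finitely many slices, each handled by induction. *)
pose N := (\max_(g <- s) g o)%N.
have [t [tP Pt]] : exists t : seq 'X_{1..n}, (forall g, g \in t -> P g) /\
    forall m, P m -> (m o < N)%N ->
      exists2 g, g \in t & forall i : 'I_n, (i < k.+1)%N -> (g i <= m i)%N.
  elim: N => [|c [t [tP Pt]]]; first by exists nil.
  have [u [uP Pu]] := IHk (fun m => P m /\ m o = c).
  exists (t ++ u); split=> [g|m Pm].
    by rewrite mem_cat => /orP[/tP|/uP[]].
  rewrite ltnS leq_eqVlt => /predU1P[mc|/(Pt m Pm)[g gt le_gm]]; last first.
    by exists g; rewrite ?mem_cat ?gt.
  have [g gu le_gm] := Pu m (conj Pm mc); exists g.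
    by rewrite mem_cat gu orbT.
  move=> i /lt_ordS[->|]; last exact: le_gm.
  by have [_ ->] := uP g gu; rewrite mc.
exists (s ++ t); split=> [g|m Pm].
  by rewrite mem_cat => /orP[/sP|/tP].
have [/(Pt m Pm)[g gt le_gm]|leN] := ltnP (m o) N.
  by exists g; rewrite // mem_cat gt orbT.
have [g gs le_gm] := Ps m Pm; exists g; first by rewrite mem_cat gs.
move=> i /lt_ordS[->|]; last exact: le_gm.
by apply: leq_trans leN; exact: leq_bigmax_seq gs isT.
Qed.

Lemma mdeg_lt n (m1 m2 : 'X_{1..n}) :
  (m1 <= m2)%MM -> m1 != m2 -> (mdeg m1 < mdeg m2)%N.
Proof.
move=> /submK <-; rewrite mdegD -[X in (X < _)%N]add0n ltn_add2r lt0n mdeg_eq0.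
by apply: contraNN => /eqP ->; rewrite add0m.
Qed.

(** The minimal elements of a finite Dickson basis suffice: going from an element to a proper
    divisor lowers the total degree, so the descent ends at a minimal one. *)
Lemma finite_antichain_basis n (A : 'X_{1..n} -> Prop) :
  exists s : seq 'X_{1..n}, {in s &, forall g h, (h <= g)%MM -> h = g} /\
    forall m, dvd_some A m <-> dvd_some (fun g => g \in s) m.
Proof.
have [t [tA At]] := dickson A.
pose s := [seq g <- t | all (fun h : 'X_{1..n} => (h <= g)%MM ==> (h == g)) t].
exists s; split=> [g h|m].
  rewrite !mem_filter => /andP[/allP ming _] /andP[_ ht] le_hg.
  by apply/eqP; apply: implyP (ming h ht) le_hg.
split=> [[a /At[g gt le_ga] le_am]|[g]]; last first.
  by rewrite mem_filter => /andP[_ /tA Ag] le_gm; exists g.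
have {a le_ga le_am} := lepm_trans le_ga le_am.
have [k] := ubnP (mdeg g); elim: k g gt => // k IHk g gt le_gk le_gm.
have [ming|] := boolP (all (fun h : 'X_{1..n} => (h <= g)%MM ==> (h == g)) t).
  by exists g; rewrite // mem_filter ming.
move=> /allPn[h ht]; rewrite negb_imply => /andP[le_hg neq_hg].
apply: (IHk h ht); last exact: lepm_trans le_gm.
by apply: leq_trans (mdeg_lt le_hg neq_hg) _.
Qed.

(** If a subset [H] of [G] still generates, each element of [G] is divisible by one of [H], and the
    antichain condition makes the two equal. *)
Lemma antichain_min_monomial_gens n (K : fieldType) (A G : 'X_{1..n} -> Prop)
    (I : {mpoly K[n]} -> Prop) :
  same_set I (monomials_ideal A) ->
  (forall m, dvd_some A m <-> dvd_some G m) ->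
  (forall g h, G g -> G h -> (h <= g)%MM -> h = g) ->
  min_monomial_gens I G.
Proof.
move=> IA AG antiG; split=> [f|H HG IH m].
  split=> [/IA/monomials_idealP Af|/monomials_idealP Gf].
    by apply/monomials_idealP => m /Af/AG.
  by apply/IA/monomials_idealP => m /Gf/AG.
split=> [/HG //|Gm]; have : dvd_some A m.
  by apply/AG; exists m => //; apply: lepm_refl.
move=> /(monomials_idealX K)/IA/IH/monomials_idealX[h Hh le_hm].
by rewrite -(antiG _ _ Gm (HG _ Hh) le_hm).
Qed.

(** * Listing an antichain by last variables *)

Definition first_vars n (t : nat) (m : 'X_{1..n}) : bool :=
  [forall l : 'I_n, (t < l.+1)%N ==> (m l == 0%N)].

Lemma first_varsP n t (m : 'X_{1..n}) :
  reflect (in_first_vars t m) (first_vars t m).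
Proof.
apply: (iffP forallP) => H l; first by move=> tl; apply/eqP/(implyP (H l)).
by apply/implyP => tl; apply/eqP/H.
Qed.

(** A sum with at most one term: [t] can then be any natural number, the value being 0 when no
    variable has number [t]. *)
Definition exponent n (t : nat) (m : 'X_{1..n}) : nat :=
  (\sum_(l < n | l.+1 == t) m l)%N.

Definition drop_var n (t : nat) (m : 'X_{1..n}) : 'X_{1..n} :=
  [multinom if l.+1 == t then 0%N else m l | l < n].

Definition pure_power n (t : nat) (m : 'X_{1..n}) : bool :=
  [forall l : 'I_n, (l.+1 != t) ==> (m l == 0%N)].

Lemma exponentE n (l : 'I_n) (m : 'X_{1..n}) : exponent l.+1 m = m l.
Proof. by rewrite /exponent (big_pred1 l). Qed.

Lemma xpowE n (l : 'I_n) e : xpow n l.+1 e = (U_(l) *+ e)%MM.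
Proof.
apply/mnmP => i; rewrite mnmE mulmnE mnm1E eqSS -val_eqE eq_sym /=.
by case: eqP; rewrite ?mul1n.
Qed.

Lemma xpow0 n t : xpow n t 0 = 0%MM.
Proof. by apply/mnmP => l; rewrite mnmE if_same mnm0E. Qed.

Lemma drop_varK n t (m : 'X_{1..n}) :
  (drop_var t m + xpow n t (exponent t m))%MM = m.
Proof.
apply/mnmP => i; rewrite mnmDE !mnmE; case: eqP => [<-|_]; last exact: addn0.
by rewrite exponentE.
Qed.

Lemma drop_var_le n t (m m' : 'X_{1..n}) e :
  (m <= m' + xpow n t e)%MM -> (drop_var t m <= m')%MM.
Proof.
move=> /mnm_lepP le_m; apply/mnm_lepP => i; rewrite mnmE.
by case: eqP => [//|/eqP/negPf ti]; have := le_m i; rewrite mnmDE mnmE ti addn0.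
Qed.

Lemma pure_powerE n t (m : 'X_{1..n}) :
  pure_power t m -> m = xpow n t (exponent t m).
Proof.
move=> /forallP pm; rewrite -[LHS](drop_varK t); set x := xpow _ _ _.
suff ->: drop_var t m = 0%MM by rewrite add0m.
apply/mnmP => i; rewrite mnmE mnm0E; case: eqP => // /eqP ti.
by apply/eqP/(implyP (pm i)).
Qed.

Lemma first_vars_drop n t (m : 'X_{1..n}) :
  first_vars t.+1 m -> first_vars t (drop_var t.+1 m).
Proof.
move=> /first_varsP mt; apply/first_varsP => l tl; rewrite mnmE.
by case: eqP => // /eqP lt; apply: mt; lia.
Qed.

(** For the ideal generated by [s], the second and third hypotheses exclude the zero and the unit
    ideal; the last is the exchange property with variables numbered from 1. *)
Lemma exists_listing n (s : seq 'X_{1..n}) :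
  {in s &, forall g h, (h <= g)%MM -> h = g} ->
  (exists g, g \in s) -> 0%MM \notin s ->
  (forall t t' m k, (1 <= t <= t')%N -> (t' <= n)%N ->
     dvd_some (fun g => g \in s) (m + xpow n t' k)%MM ->
     exists N, dvd_some (fun g => g \in s) (m + xpow n t N)%MM) ->
  exists q r v a b, listing_conditions q r v a b /\
    forall m : 'X_{1..n}, listed_gens q r v a b m <-> m \in s.
Proof.
move=> anti [g0 g0s] s0 E.
have n_gt0 : (0 < n)%N.
  case: (posnP n) => // n0; case/negP: s0; suff <- : g0 = 0%MM by [].
  by apply/mnmP => i; have := ltn_ord i; lia.
pose pure t := has (pure_power t) s.
have pureS t m k : m = xpow n t k -> dvd_some (fun g => g \in s) m -> pure t.
  move=> -> [g gs /mnm_lepP le_g]; apply/hasP; exists g => //.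
  apply/forallP => l; apply/implyP => lt; have := le_g l.
  by rewrite mnmE (negPf lt) leqn0.
(* Starting from [g0], the last variable is repeatedly traded for [x_1], until a power of [x_1]
   remains. *)
have pure1 : pure 1%N.
  suff H t : (1 <= t <= n)%N -> forall m, first_vars t m ->
      dvd_some (fun g => g \in s) m -> pure 1%N.
    apply: (H n _ g0); rewrite ?leqnn ?n_gt0 //.
      by apply/first_varsP => l; rewrite ltnNge ltn_ord.
    by exists g0 => //; apply: lepm_refl.
  elim: t => // -[_|t IHt] t_le m mt Dm.
    apply: pureS (exponent 1 m) _ Dm; apply: pure_powerE.
    apply/forallP => l; apply/implyP => l1.
    by apply: (implyP (forallP mt l)); lia.
  rewrite -(drop_varK t.+2 m) in Dm.
  have [||N DN] := E 1%N t.+2 _ _ _ _ Dm; [lia..|].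
  apply: IHt DN; first by lia.
  apply/first_varsP => l tl; rewrite mnmDE.
  rewrite (first_varsP _ _ (first_vars_drop mt)) // mnmE.
  by case: eqP => //; lia.
pose inpure t := (0 < t <= n)%N && pure t.
have inpure_ex : exists t, inpure t by exists 1%N; rewrite /inpure n_gt0.
have inpure_le t : inpure t -> (t <= n)%N by case/andP => /andP[].
pose q := ex_maxn inpure_ex inpure_le.
have [q_bounds pure_q q_max] :
    [/\ (1 <= q <= n)%N, pure q & forall t, (q < t <= n)%N -> ~~ pure t].
  rewrite /q; case: ex_maxnP => t /andP[t_bd pt] t_max.
  split=> // t' /andP[lt_tt' le_t'n].
  apply/negP => pt'; have := t_max t'; rewrite /inpure pt'; lia.
(* The exchange property at the monomial 1 turns a power of [x_q] into a power of [x_t]. *)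
have pure_le t : (1 <= t <= q)%N -> pure t.
  move=> t_q; have /hasP[g gs /pure_powerE g_q] := pure_q.
  have [||N DN] := E t q 0%MM (exponent q g) t_q.
  - by lia.
  - by rewrite add0m -g_q; exists g => //; apply: lepm_refl.
  - by rewrite add0m in DN; apply: pureS DN.
pose p t := nth 0%MM s (find (pure_power t) s).
have p_s t : pure t -> p t \in s by rewrite /pure has_find; apply: mem_nth.
have pE t : pure t -> p t = xpow n t (exponent t (p t)).
  by move=> pt; apply: pure_powerE; apply: nth_find.
(* For positive [i], these are the generators with last variable [x_(q+i)]. Block 0 takes every
   generator in the first [q] variables, pure powers included; these are listed twice, which is
   harmless since the listing is a set. *)
pose block i := [seq g : 'X_{1..n} <- s | first_vars (q + i) g &
                   (i == 0%N) || (0 < exponent (q + i) g)%N].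
(* The index [j] starts at 1 and [nth] at 0, hence [j.-1]. Generators of block 0 are kept whole. *)
pose v i j := let g := nth 0%MM (block i) j.-1 in
              if i is 0%N then g else drop_var (q + i)%N g.
have vE i j : (0 < i)%N -> v i j = drop_var (q + i) (nth 0%MM (block i) j.-1).
  by case: i.
have blockP i j : (1 <= j <= size (block i))%N ->
    exists g, [/\ g \in s, nth 0%MM (block i) j.-1 = g, first_vars (q + i) g &
                 (i == 0%N) || (0 < exponent (q + i) g)%N].
  move=> j_r; have : nth 0%MM (block i) j.-1 \in block i by apply: mem_nth; case: j j_r.
  rewrite mem_filter => /andP[/andP[H1 H2] H3].
  by exists (nth 0%MM (block i) j.-1).
have indexP i g : g \in block i -> exists j, (1 <= j <= size (block i))%N /\
    nth 0%MM (block i) j.-1 = g.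
  by move=> gB; exists (index g (block i)).+1; rewrite /= nth_index // index_mem.
have dvd_prev i j : (2 <= i <= n - q)%N -> (1 <= j <= size (block i))%N ->
    exists k, (1 <= k <= size (block i.-1))%N /\ (v i.-1 k <= v i j)%MM.
  case: i => [|[|i]] // i_q /blockP[g [gs gE]]; rewrite /v gE /=.
  have -> : (q + i.+2 = (q + i.+1).+1)%N by rewrite !addnS.
  set t := (q + i.+1)%N => /= gt g_gt0; set u := drop_var _ g.
  have u_t : first_vars t u by apply: first_vars_drop.
  have Dg : dvd_some (fun g => g \in s) (u + xpow n t.+1 (exponent t.+1 g))%MM.
    by rewrite drop_varK; exists g => //; apply: lepm_refl.
  have [||N [h hs le_h]] := E t t.+1 _ _ _ _ Dg; [rewrite /t; lia..|].
  have h_t : first_vars t h.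
    apply/first_varsP => l tl; apply/eqP; rewrite -leqn0.
    apply: leq_trans (mnm_lepP le_h l) _.
    rewrite mnmDE (first_varsP _ _ u_t) // mnmE.
    by case: eqP => // lt; move: tl; rewrite lt ltnn.
  have le_hu := drop_var_le le_h.
  (* Otherwise [h] divides [u], hence [g], so [h = g] by the antichain condition; but [g] involves
     [x_(t+1)] and [u] does not. *)
  have h_gt0 : (0 < exponent t h)%N.
    rewrite lt0n; apply/eqP => h0.
    have hu : (h <= u)%MM. by rewrite -(drop_varK t h) h0 xpow0 addm0.
    have hg : h = g.
      apply: anti => //; apply: lepm_trans hu _.
      by rewrite -[X in (_ <= X)%MM](drop_varK t.+1); apply: lem_addr.
    have t_n : (t < n)%N by rewrite /t; lia.
    have := mnm_lepP hu (Ordinal t_n); rewrite hg mnmE eqxx leqn0.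
    by rewrite -exponentE -leqn0 leqNgt g_gt0.
  have [|k [k_r kE]] := indexP i.+1 h.
    by rewrite mem_filter -/t h_t h_gt0 hs.
  by exists k; split=> //; rewrite kE.
exists q, (fun i => size (block i)), v, (fun t => exponent t (p t)),
  (fun i j => exponent (q + i) (nth 0%MM (block i) j.-1)).
split; first split=> //.
- by move=> j /blockP[g [_ gE /first_varsP + _]]; rewrite /v gE addn0.
- move=> [|i] // j i_q /blockP[g [_ gE gt _]]; rewrite /v gE.
  by rewrite addnS subn1; apply/first_varsP/first_vars_drop; rewrite -addnS.
- move=> t /pure_le pt; rewrite lt0n; apply: contraNneq s0 => p0.
  suff <- : p t = 0%MM by apply: p_s.
  by rewrite pE // p0 xpow0.
- by move=> [|i] // j _ /blockP[g [_ -> _ ]].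
- move=> i i1 i_q r_gt0; have [||k [k_r _]] := dvd_prev i.+1 1%N; [lia..|].
  by rewrite /= in k_r; lia.
move=> m; split.
  case=> [[t [/pure_le pt ->]]|[j [/blockP[g [gs gE _ _]] ->]]
         |[i [j [i_q /blockP[g [gs gE _ _]] ->]]]].
  - by rewrite -pE // p_s.
  - by rewrite /v gE.
  - by case: i i_q gE => // i _ gE; rewrite /v gE drop_varK.
move=> ms; have [mq|mq] := boolP (first_vars q m).
  have [|j [j_r jE]] := indexP 0%N m; first by rewrite mem_filter addn0 mq ms.
  by apply: Or32; exists j; rewrite /v jE.
(* The last variable of [m] is [x_(t+1)], found as the largest ordinal with nonzero exponent; it
   comes after [x_q], so [m] belongs to block [t.+1 - q]. *)
have [t [tq t_n mt m_gt0]] : exists t, [/\ (q <= t)%N, (t < n)%N,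
    first_vars t.+1 m & (0 < exponent t.+1 m)%N].
  move: mq => /forallPn[l0]; rewrite negb_imply => /andP[l0q ml0].
  case: (@arg_maxnP _ l0 (fun l => m l != 0%N) (fun l => val l) ml0).
  move=> l ml l_max.
  exists l; split=> //.
  - by apply: leq_trans (l_max _ ml0).
  - apply/forallP => i; apply/implyP => li; apply: contraTT li => mi.
    by rewrite -leqNgt ltnS; apply: l_max.
  - by rewrite exponentE lt0n.
have tE : (q + (t.+1 - q) = t.+1)%N by lia.
have [|j [j_r jE]] := indexP (t.+1 - q)%N m.
  by rewrite mem_filter tE mt m_gt0 ms orbT.
apply: Or33; exists (t.+1 - q)%N, j; split=> //; first by lia.
by rewrite vE ?subn_gt0 ?ltnS // jE tE drop_varK.
Qed.

(** * From a listing back to Borel type *)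

Lemma listing_dvd_chain n q r v a b (i i' j : nat) :
  @listing_conditions n q r v a b ->
  (1 <= i' <= i)%N -> (i <= n - q)%N -> (1 <= j <= r i)%N ->
  exists t, (1 <= t <= r i')%N /\ (v i' t <= v i j)%MM.
Proof.
move=> LC; elim: i j => [|i IHi] j; first by lia.
case/andP=> i'1; rewrite leq_eqVlt => /predU1P[->|lt_i] i_q j_r.
  by exists j; split=> //; apply: lepm_refl.
have [|k [k_r k_v]] := lc_dvd LC _ j_r; first by lia.
have [||t [t_r t_v]] := IHi k _ _ k_r; [lia..|].
by exists t; split=> //; apply: lepm_trans t_v k_v.
Qed.

Lemma borel_exchange_of_listing n q r v a b (j l : 'I_n) m k :
  listing_conditions q r v a b -> (l <= j)%N ->
  dvd_some (listed_gens q r v a b) (m + U_(j) *+ k)%MM ->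
  exists N, dvd_some (listed_gens q r v a b) (m + U_(l) *+ N)%MM.
Proof.
move=> LC le_lj [g Gg le_g]; have := lc_q LC => q_n.
have l_n := ltn_ord l; have j_n := ltn_ord j.
(* A listed pure power of this variable will do, whatever [m] is. *)
have [le_lq|lt_ql] := leqP l.+1 q.
  exists (a l.+1), (xpow n l.+1 (a l.+1)); first by apply: Or31; exists l.+1.
  by rewrite xpowE; apply: lem_addl.
(* If [g] does not involve the variable being traded, it already divides [m]. *)
have [gj0|gj_gt0] := posnP (g j).
  exists 0%N, g => //; rewrite mulm0n addm0; apply/mnm_lepP => i.
  have := mnm_lepP le_g i; rewrite mnmDE mulmnE mnm1E.
  by case: eqP => [<-|_]; rewrite ?gj0 // addn0.
(* Here [g] involves a variable beyond [x_q], so it comes from a block [i0] whose last variable is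
   that one or a later one. Its factor [v i0 j0] can exceed [m] only at [j], where [m] was
   multiplied by a power. *)
have [i0 [i0_q [j0 [j0_r j0_m]]]] : exists i0, (j.+1 - q <= i0 <= n - q)%N /\
    exists j0, (1 <= j0 <= r i0)%N /\
      forall i : 'I_n, i != j -> (v i0 j0 i <= m i)%N.
  case: Gg gj_gt0 le_g => [[t [t_q ->]]|[t [t_r ->]]|[i [t [i_q t_r ->]]]].
  - by rewrite mnmE; case: eqP => // jt; lia.
  - by rewrite (lc_v0 LC t_r) //; lia.
  rewrite mnmDE mnmE => gj_gt0 /mnm_lepP le_g; exists i; split.
    apply/andP; split; last by lia.
    rewrite leqNgt; apply/negP => lt_i; move: gj_gt0.
    by rewrite (lc_v LC i_q t_r) ?add0n; [case: eqP => //; lia | lia].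
  exists t; split=> // l' neq_lj; have := le_g l'.
  rewrite !mnmDE mulmnE mnm1E eq_sym (negPf neq_lj) mul0n addn0.
  by apply: leq_trans; apply: leq_addr.
have [||t [t_r t_v]] := @listing_dvd_chain _ _ _ _ _ _ i0 (l.+1 - q) j0 LC _ _ j0_r;
  [lia..|].
have tq : (1 <= l.+1 - q <= n - q)%N by lia.
(* At [j] the exponent of this [v] is 0: it involves only variables before the one indexed by [l],
   and [l <= j]. *)
have v_m : (v (l.+1 - q)%N t <= m)%MM.
  apply/mnm_lepP => i; have [->|neq_ij] := eqVneq i j.
    by rewrite (lc_v LC tq t_r) //; lia.
  exact: leq_trans (mnm_lepP t_v i) (j0_m i neq_ij).
pose e := b (l.+1 - q)%N t.
exists e, (v (l.+1 - q)%N t + xpow n (q + (l.+1 - q)) e)%MM.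
  by apply: Or33; exists (l.+1 - q)%N, t.
have -> : (q + (l.+1 - q) = l.+1)%N by lia.
by rewrite xpowE; apply/mnm_lepP => i; rewrite !mnmDE leq_add2r (mnm_lepP v_m).
Qed.

Theorem theorem2p1 (K : fieldType) (K_infinite : infinite_type K)
    (n : nat) (n_ge2 : (2 <= n)%N) (I : {mpoly K[n]} -> Prop) :
  (borel_type I -> (exists f, I f /\ f <> 0) -> ~ I 1 ->
     exists (q : nat) (r : nat -> nat) (v : nat -> nat -> 'X_{1..n})
            (a : nat -> nat) (b : nat -> nat -> nat),
       listing_conditions q r v a b /\
       min_monomial_gens I (listed_gens q r v a b))
  /\
  (monomial_ideal I ->
     (exists (q : nat) (r : nat -> nat) (v : nat -> nat -> 'X_{1..n})
             (a : nat -> nat) (b : nat -> nat -> nat),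
        listing_conditions q r v a b /\
        min_monomial_gens I (listed_gens q r v a b)) ->
     borel_type I).
Proof.
split=> [BI [f [If f0]] I1 | _ [q [r [v [a [b [LC [IG _]]]]]]]]; last first.
  apply/(borel_typeP IG) => j l m k le_lj.
  exact: borel_exchange_of_listing LC le_lj.
have [[A IA] _] := BI; have [s [anti_s sA]] := finite_antichain_basis A.
have mem_dvd_some g : g \in s -> dvd_some (fun g => g \in s) g.
  by move=> gs; exists g => //; apply: lepm_refl.
have [|||q [r [v [a [b [LC Gs]]]]]] := @exists_listing n s anti_s.
(* A nonzero element of [I] has a monomial, and some element of [s] divides it. *)
- case fE: (msupp f) => [|m t]; first by case: f0; apply: msuppnil0.
  have /IA/monomials_idealP Af := If.
  have /Af/sA[g gs _] : m \in msupp f by rewrite fE mem_head.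
  by exists g.
(* The exponent vector 0 is the monomial 1, which would put 1 in [I]. *)
- apply/negP => s0; case: I1; apply/IA; rewrite -mpolyX0.
  by apply/monomials_idealX/sA/mem_dvd_some.
- move=> t t' m k /andP[t1 le_tt'] le_t'n.
  have t_n : (t.-1 < n)%N by lia.
  have t'_n : (t'.-1 < n)%N by lia.
  have -> : t' = (Ordinal t'_n).+1 by rewrite /= prednK //; lia.
  have tE : t = (Ordinal t_n).+1 by rewrite /= prednK.
  rewrite xpowE => /sA Am.
  have [|N AN] := (borel_typeP IA).1 BI _ (Ordinal t_n) _ _ _ Am.
    by rewrite /=; lia.
  by exists N; apply/sA; rewrite tE xpowE.
exists q, r, v, a, b; split=> //.
apply: antichain_min_monomial_gens IA _ _ => [m | g h /Gs gs /Gs hs]; last exact: anti_s.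
by rewrite sA; split=> -[g /Gs gs le_gm]; exists g.
Qed.
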